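(* For every integer $r\ge1$, \[C_r(1-q)=\frac{1}{r+1}P_r(1^{r+1};q).\]
   Context: $q$ is an indeterminate. The Narayana numbers are $N(n,k)=\frac1n\binom{n}{k-1}\binom{n}{k}$, and the Narayana polynomials are $C_0(q)=1$ and $C_n(q)=\sum_{k=1}^n N(n,k)q^{k-1}$ for $n\ge1$. For an alphabet $x=(x_1,x_2,\ldots)$, the one-row Hall–Littlewood symmetric function is $P_0(x;q)=1$ and, for $r\ge1$, $P_r(x;q)=(1-q)^{-1}g_r(x;q)$, where $\sum_{k\ge0}u^k g_k(x;q)=\prod_{i\ge1}\frac{1-qux_i}{1-ux_i}$. $P_r(1^{m};q)$ denotes the value of $P_r(x;q)$ at the $m$-vector $(1,\ldots,1)$. *)

(* Defs.v *)
From HB Require Import structures.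
From mathcomp Require Import all_boot all_order all_algebra.
From mathcomp Require Import fraction mpoly.

Set Implicit Arguments.
Unset Strict Implicit.
Unset Printing Implicit Defensive.

Import GRing.Theory.
Local Open Scope ring_scope.

Definition narayana (n k : nat) : rat :=
  n%:R^-1 * 'C(n, k.-1)%:R * 'C(n, k)%:R.

Definition narayana_poly (n : nat) : {poly rat} :=
  if n is 0 then 1 else \sum_(1 <= k < n.+1) narayana n k *: 'X^(k.-1).

(* A formal power series in u over R is its sequence of coefficients. *)
Section FormalPowerSeries.
Variable R : comNzRingType.
Implicit Types (s t : nat -> R) (a : R).

Definition fps_one : nat -> R := fun k => (k == 0)%:R.

Definition fps_mul s t : nat -> R := fun k => \sum_(i < k.+1) s i * t (k - i)%N.

(* 1 - a u *)
Definition fps_lin a : nat -> R :=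
  fun k => if k is k'.+1 then (if k' is 0 then - a else 0) else 1.

(* 1 / (1 - a u); fps_lin_geom below shows that it is the inverse. *)
Definition fps_geom a : nat -> R := fun k => a ^+ k.

Lemma fps_lin_geom a : fps_mul (fps_lin a) (fps_geom a) =1 fps_one.
Proof.
case=> [|k]; rewrite /fps_mul /fps_one /fps_geom.
  by rewrite big_ord_recl big_ord0 /= mul1r addr0.
rewrite 2!big_ord_recl big1 => [|i _] /=; last by rewrite mul0r.
by rewrite subn0 addr0 mul1r subSS subn0 mulNr -exprS subrr.
Qed.

End FormalPowerSeries.

(* The field Q(q) of scalars. *)
Definition Qq := {fraction {poly rat}}.

Definition q : Qq := tofrac 'X.

(* The alphabet consists of the m variables x_0, ..., x_(m-1); this is the     *)
(* image of the symmetric function when all the other variables are set to 0. *)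
Definition hl_g (m k : nat) : {mpoly Qq[m]} :=
  (\big[@fps_mul _/@fps_one _]_(i < m)
     fps_mul (fps_lin (q%:MP * 'X_i)) (fps_geom 'X_i)) k.

Definition hl_P (m r : nat) : {mpoly Qq[m]} :=
  if r is 0 then 1 else (1 - q)^-1 *: hl_g m r.

(* P_r(1^m; q) *)
Definition hl_P_ones (m r : nat) : Qq := (hl_P m r).@[fun _ => 1].

(* Main.v *)
Require Import Defs.
From mathcomp Require Import all_boot all_order all_algebra.
From mathcomp Require Import fraction mpoly.
From mathcomp Require Import ring.

(** With [p = 1 - q] one has [(1 - q u) / (1 - u) = 1 + p u / (1 - u)], so the
    coefficient of [u^(r+1)] in its [m]-th power is
    [\sum_k 'C(m, k+1) 'C(r, k) p^(k+1)].  For [m = r + 2] its terms are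
    multiples of Narayana numbers, by the absorption identity. *)

Import GRing.Theory.
Local Open Scope ring_scope.

Section PowerCoefficients.
Variables (R : comNzRingType) (p : R).

(** ['C(m, k.+1)] chooses the factors contributing a positive power of [u]; ['C(r', k)] counts the
    compositions of [r'.+1] into [k.+1] positive parts. *)
Definition pow_coef (m r : nat) : R :=
  if r is r'.+1 then \sum_(k < m) ('C(m, k.+1) * 'C(r', k))%:R * p ^+ k.+1
  else 1.

(** Induction on [r]: each new coefficient is absorbed by Pascal's rule in [r]. *)
Lemma sum_pow_coef m r :
  \sum_(i < r.+1) pow_coef m i = \sum_(k < m.+1) ('C(m, k) * 'C(r, k))%:R * p ^+ k.
Proof.
elim: r => [|r IHr].
  rewrite big_ord1 big_ord_recl big1 => [|k _] /=; last by rewrite muln0 mul0r.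
  by rewrite !bin0 mulr1 addr0.
rewrite big_ord_recr /= IHr !big_ord_recl /= !bin0 -addrA -big_split /=.
congr (_ + _); apply: eq_bigr => k _.
by rewrite /bump !add1n -mulrDl -natrD -mulnDr -binS.
Qed.

(** One more factor [1 + p u / (1 - u)]: its second term adds [p] times the sum of all lower
    coefficients. The proof is Pascal's rule in [m]. *)
Lemma pow_coefS m r :
  pow_coef m.+1 r.+1 = pow_coef m r.+1 + p * \sum_(i < r.+1) pow_coef m i.
Proof.
rewrite sum_pow_coef /= mulr_sumr.
have -> : \sum_(k < m) ('C(m, k.+1) * 'C(r, k))%:R * p ^+ k.+1 =
          \sum_(k < m.+1) ('C(m, k.+1) * 'C(r, k))%:R * p ^+ k.+1.
  by rewrite [RHS]big_ord_recr /= bin_small // mul0n mul0r addr0.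
rewrite -big_split; apply: eq_bigr => k _ /=.
by rewrite binS mulnDl natrD exprS; ring.
Qed.

End PowerCoefficients.

Arguments pow_coef {R} p m r.

Lemma rmorph_fps_mul (R S : comNzRingType) (f : {rmorphism R -> S})
    (s t : nat -> R) k :
  f (fps_mul s t k) = fps_mul (f \o s) (f \o t) k.
Proof. by rewrite rmorph_sum; apply: eq_bigr => i _; rewrite rmorphM. Qed.

Lemma fps_lin_mul_geom1 (R : comNzRingType) (a : R) k :
  fps_mul (fps_lin a) (fps_geom 1) k = if k is 0 then 1 else 1 - a.
Proof.
case: k => [|k]; rewrite /fps_mul /fps_geom.
  by rewrite big_ord1 /= expr1n mulr1.
rewrite 2!big_ord_recl big1 => [|i _] /=; last by rewrite mul0r.
by rewrite !expr1n !mulr1 addr0.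
Qed.

Lemma fps_mul_pow_coef (R : comNzRingType) (p : R) m r :
  fps_mul (fun k => if k is 0 then 1 else p) (pow_coef p m) r =
  pow_coef p m.+1 r.
Proof.
case: r => [|r]; rewrite /fps_mul; first by rewrite big_ord1 mulr1.
rewrite pow_coefS big_ord_recl mul1r subn0; congr (_ + _).
(* Reversing the index turns convolution with the constant [p] into a partial sum. *)
rewrite mulr_sumr (reindex_inj rev_ord_inj); apply: eq_bigr => i _ /=.
by rewrite /bump add1n subSS subSS subKn // -ltnS.
Qed.

Lemma rmorph_fps_lin (R S : comNzRingType) (f : {rmorphism R -> S}) (a : R) k :
  f (fps_lin a k) = fps_lin (f a) k.
Proof. by case: k => [|[|k]] /=; rewrite ?rmorph1 ?rmorph0 ?rmorphN. Qed.

Lemma rmorph_big_fps_mul (R S : comNzRingType) (f : {rmorphism R -> S})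
    (I : finType) (s : I -> nat -> R) (p : S) k :
  (forall i l, f (s i l) = if l is 0 then 1 else p) ->
  f ((\big[@fps_mul R/@fps_one R]_(i : I) s i) k) = pow_coef p #|I| k.
Proof.
(* Writing the cardinal as a size allows induction over an arbitrary list of factors. *)
move=> fs; have <- : size (index_enum I) = #|I|.
  by rewrite [index_enum _]unlock -enumT cardT.
elim: (index_enum I) k => [|i r IHr] k /=.
  rewrite big_nil /fps_one rmorph_nat.
  by case: k => //= k; rewrite big_ord0.
rewrite big_cons rmorph_fps_mul -fps_mul_pow_coef.
by apply: eq_bigr => j _ /=; rewrite fs IHr.
Qed.

(** At [1] every factor becomes the same series [(1 - q u) / (1 - u)]. *)
Lemma meval_hl_g m r : (hl_g m r).@[fun _ => 1] = pow_coef (1 - q) m r.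
Proof.
rewrite -[in RHS](card_ord m) /hl_g; apply: rmorph_big_fps_mul => i l.
rewrite rmorph_fps_mul -fps_lin_mul_geom1; apply: eq_bigr => n _.
congr (_ * _); last by rewrite /= /fps_geom rmorphXn /= mevalXU.
by rewrite /comp rmorph_fps_lin rmorphM /= mevalC mevalXU mulr1.
Qed.

Lemma narayanaE r k :
  narayana r.+1 k.+1 = r.+2%:R^-1 * ('C(r.+2, k.+1) * 'C(r, k))%:R.
Proof.
have nz n : n.+1%:R != 0 :> rat by rewrite Num.Theory.pnatr_eq0.
rewrite /narayana -mulrA -natrM /=.
(* With denominators cleared, absorption brings both sides to
   [k.+1 * 'C(r.+2, k.+1) * 'C(r.+1, k.+1)]. *)
apply: (mulfI (nz r)); apply: (mulfI (nz r.+1)).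
rewrite mulVKf // [X in _ = X]mulrCA mulVKf // -!natrM; congr (_%:R).
rewrite mulnA (mul_bin_diag r.+2 k) mulnCA (mul_bin_diag r.+1 k).
by rewrite mulnCA mulnA.
Qed.

Lemma tofrac_invn_scale n (s : {poly rat}) :
  tofrac (n.+1%:R^-1 *: s) = n.+1%:R^-1 * tofrac s.
Proof.
have natE : n.+1%:R = tofrac n.+1%:R :> Qq by rewrite rmorph_nat.
have nz : n.+1%:R != 0 :> Qq.
  by rewrite natE tofrac_eq0 -polyC_natr polyC_eq0 Num.Theory.pnatr_eq0.
apply: (mulfI nz); rewrite mulVKf // natE -tofracM mulr_natl -scaler_nat.
by rewrite scalerA divff ?scale1r // Num.Theory.pnatr_eq0.
Qed.

Theorem theorem2 (r : nat) (hr : (1 <= r)%N) :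
  tofrac (narayana_poly r \Po (1 - 'X)) = r.+1%:R^-1 * hl_P_ones r.+1 r.
Proof.
case: r hr => // r _.
have p_neq0 : 1 - q != 0.
  rewrite /q -tofrac1 -tofracB tofrac_eq0 -oppr_eq0 opprB.
  by rewrite -polyC1 polyXsubC_eq0.
rewrite /hl_P_ones /hl_P mevalZ meval_hl_g /= big_add1 big_mkord.
(* The term [k = r.+1], absent from the Narayana sum, vanishes since ['C(r, r.+1) = 0]. *)
rewrite [in RHS]big_ord_recr /= (bin_small (ltnSn r)).
rewrite muln0 mul0r addr0 !mulr_sumr raddf_sum rmorph_sum.
apply: eq_bigr => k _ /=.
rewrite comp_polyZ comp_Xn_poly narayanaE -scalerA tofrac_invn_scale.
rewrite scaler_nat -(mulr_natl (_ ^+ _)) tofracM rmorph_nat tofracXn tofracB tofrac1.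
(* The prefactor [(1 - q)^-1] cancels one power of [1 - q]. *)
by rewrite exprS [in RHS](mulrCA _%:R) mulKf.
Qed.
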